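(* Let $(X,\cdot)$ be a group and let $\big((X,\cdot)\xrightarrow{f_j}(X_j,\cdot)\big)_{j\in J}$ be a family of group homomorphisms, where each $(X_j,\cdot,\mathbb{C}_j)$ is a stratified $L$-convex group. Then there is a unique stratified $L$-convex structure $\mathbb{C}$ on $X$ such that $(X,\cdot,\mathbb{C})$ is a stratified $L$-convex group and (1) each $f_j:(X,\cdot,\mathbb{C})\to(X_j,\cdot,\mathbb{C}_j)$ is an LCP group homomorphism; (2) for every stratified $L$-convex group $(Y,\cdot,\mathbb{G})$, a group homomorphism $f:(Y,\cdot,\mathbb{G})\to(X,\cdot,\mathbb{C})$ is an LCP if and only if all $f_j\circ f:(Y,\cdot,\mathbb{G})\to(X_j,\cdot,\mathbb{C}_j)$ ($j\in J$) are LCPs. That is, every $U$-source in $\mathbf{SLCG}$ has a unique $U$-initial lift; hence $\mathbf{SLCG}$ is a topological category over $\mathbf{Grp}$.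
   Context: Throughout, $L=(L,\le,\top,\bot,\wedge,\vee,{}')$ is a completely distributive De Morgan algebra (a completely distributive complete lattice with greatest element $\top$, least element $\bot$, and an order-reversing involution $'$). $L^X$ is the set of maps $X\to L$ with pointwise order and operations; $\hat a\in L^X$ is the constant map with value $a\in L$. A stratified $L$-convex structure on $X$ is a family $\mathbb{C}\subseteq L^X$ such that $\hat a\in\mathbb{C}$ for all $a\in L$, $\mathbb{C}$ is closed under arbitrary pointwise infima, and $\mathbb{C}$ is closed under pointwise suprema of directed subfamilies; $(X,\mathbb{C})$ is then a stratified $L$-convex space. A map $f:(X,\mathbb{C})\to(Y,\mathbb{G})$ is an LCP ($L$-convexity-preserving map) if $f^{\leftarrow}(A)=A\circ f\in\mathbb{C}$ for all $A\in\mathbb{G}$. For $A,B\in L^X$, $A\times B\in L^{X\times X}$ is $(x_1,x_2)\mapsto A(x_1)\wedge B(x_2)$. The product structure $\mathbb{C}\times\mathbb{C}$ on $X\times X$ is the initial (smallest) stratified $L$-convex structure making both projections LCPs; it equals $\{C_1\times C_2\mid C_1,C_2\in\mathbb{C}\}$. A stratified $L$-convex group $(X,\cdot,\mathbb{C})$ is a group $(X,\cdot)$ with a stratified $L$-convex structure $\mathbb{C}$ on $X$ such that multiplication $(X\times X,\mathbb{C}\times\mathbb{C})\to(X,\mathbb{C})$ and inversion $(X,\mathbb{C})\to(X,\mathbb{C})$ are LCPs. $\mathbf{SLCG}$ is the category of stratified $L$-convex groups and LCP group homomorphisms, a concrete category over the category $\mathbf{Grp}$ of groups via the forgetful functor $U$.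 A $U$-source is a family of $\mathbf{Grp}$-morphisms $(X,\cdot)\to U(X_j,\cdot,\mathbb{C}_j)$ as in the claim, and a $U$-initial lift is a $\mathbb{C}$ as in (1)–(2). A concrete category $(\mathbf{A},U)$ over $\mathbf{X}$ is topological over $\mathbf{X}$ if every $U$-source has a unique $U$-initial lift. *)

(* Defs.v *)
From HB Require Import structures.
From mathcomp Require Import all_boot all_order.
From mathcomp Require Import boolp classical_sets.

Set Implicit Arguments.
Unset Strict Implicit.
Unset Printing Implicit Defensive.

Local Open Scope classical_set_scope.

(* [supremum \bot] and [infimum \top] use their default value exactly on the
   empty set, where it is the correct supremum, resp. infimum. *)
Definition Sup d (L : tbLatticeType d) (A : set L) : L := supremum \bot%O A.
Definition Inf d (L : tbLatticeType d) (A : set L) : L := infimum \top%O A.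

(* Existence of all suprema is enough for completeness: the infimum of a set
   is the supremum of its lower bounds. *)
Definition complete_lattice d (L : tbLatticeType d) : Prop :=
  forall A : set L, supremums A !=set0.

Definition completely_distributive d (L : tbLatticeType d) : Prop :=
  forall (I : Type) (K : I -> Type) (a : forall i, K i -> L),
    Inf (range (fun i => Sup (range (a i)))) =
    Sup (range (fun phi : forall i, K i =>
      Inf (range (fun i => a i (phi i))))).

(* The involution [neg] is not assumed to be a complement. *)
HB.mixin Record TBLattice_isCDDeMorgan (d : Order.disp_t) L
    of Order.TBLattice d L := {
  neg : L -> L;
  negK : involutive neg;
  neg_anti : forall x y : L, (x <= y)%O -> (neg y <= neg x)%O;
  cddm_complete : complete_lattice L;
  cddm_distributive : completely_distributive L;
}.

#[short(type="cdDeMorganType")]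
HB.structure Definition CDDeMorgan (d : Order.disp_t) :=
  {L of TBLattice_isCDDeMorgan d L & Order.TBLattice d L}.

Section Convex.
Context {d : Order.disp_t} {L : cdDeMorganType d}.

Definition pSup (X : Type) (F : set (X -> L)) : X -> L :=
  fun x => Sup [set A x | A in F].
Definition pInf (X : Type) (F : set (X -> L)) : X -> L :=
  fun x => Inf [set A x | A in F].

(* Functions into a lattice carry the pointwise order. *)
Definition directed (X : Type) (F : set (X -> L)) : Prop :=
  F !=set0 /\
  forall A B, F A -> F B -> exists D, [/\ F D, (A <= D)%O & (B <= D)%O].

Record stratified_convex (X : Type) (C : set (X -> L)) : Prop := {
  convex_cst : forall a : L, C (fun=> a);
  convex_inf : forall F, F `<=` C -> C (pInf F);
  convex_dsup : forall F, F `<=` C -> directed F -> C (pSup F)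
}.

Definition LCP (X Y : Type) (C : set (X -> L)) (G : set (Y -> L))
    (f : X -> Y) : Prop :=
  forall A, G A -> C (A \o f).

Definition prod_convex (X Y : Type) (C : set (X -> L)) (G : set (Y -> L)) :
    set (X * Y -> L) :=
  \bigcap_(E in [set E | [/\ stratified_convex E, LCP E C fst & LCP E G snd]]) E.

Record convex_group (X : groupType) (C : set (X -> L)) : Prop := {
  convex_group_convex : stratified_convex C;
  convex_group_mul : LCP (prod_convex C C) C (fun p : X * X => (p.1 * p.2)%g);
  convex_group_inv : LCP C C (fun x : X => (x^-1)%g)
}.

End Convex.

Record slcg d (L : cdDeMorganType d) := SLCGroup {
  slcg_group :> groupType;
  slcg_convex : set (slcg_group -> L);
  slcg_ax : convex_group slcg_convex
}.
Arguments slcg_convex {d L} s.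

Notation group_hom := UMagmaMorphism.type.

Record category := Category {
  Ob :> Type;
  Hom : Ob -> Ob -> Type;
  idm : forall a, Hom a a;
  comp : forall a b c, Hom b c -> Hom a b -> Hom a c;
  comp_idl : forall a b (f : Hom a b), comp (idm b) f = f;
  comp_idr : forall a b (f : Hom a b), comp f (idm a) = f;
  comp_assoc : forall a b c e (h : Hom c e) (g : Hom b c) (f : Hom a b),
    comp h (comp g f) = comp (comp h g) f
}.
Arguments idm {_} a.

Record functor (A B : category) := Functor {
  fob :> A -> B;
  fmap : forall a b, Hom a b -> Hom (fob a) (fob b);
  fmap_id : forall a, fmap (idm a) = idm (fob a);
  fmap_comp : forall a b c (g : Hom b c) (f : Hom a b),
    fmap (comp g f) = comp (fmap g) (fmap f)
}.

Record concrete_category (B : category) := ConcreteCategory {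
  carrier :> category;
  forget : functor carrier B;
  forget_faithful : forall (a b : carrier) (f g : Hom a b),
    fmap forget f = fmap forget g -> f = g
}.

Section Topological.
Variables (B : category) (A : concrete_category B).
Local Notation U := (forget A).

Definition is_morphism (a b : A) (f : Hom (U a) (U b)) : Prop :=
  exists g : Hom a b, fmap U g = f.

Record source := Source {
  src_dom : B;
  src_idx : Type;
  src_cod : src_idx -> A;
  src_arr : forall j, Hom src_dom (U (src_cod j))
}.

(* A lift lies strictly over the domain of the source, whose arrows are
   therefore transported along the equality [e]. *)
Definition initial_lift (S : source) (a : A) : Prop :=
  exists e : U a = src_dom S,
    let f j := eq_rect_r (fun x => Hom x (U (src_cod j))) (@src_arr S j) e in
    (forall j, is_morphism (f j)) /\
    (forall (b : A) (h : Hom (U b) (U a)),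
        is_morphism h <-> forall j, is_morphism (comp (f j) h)).

Definition topological : Prop :=
  forall S : source, exists! a : A, initial_lift S a.

End Topological.

Section Categories.

Lemma group_hom_eq (X Y : groupType) (f g : group_hom X Y) :
  (f : X -> Y) = g -> f = g.
Proof.
case: f g => f [[f1] [fM]] [g [[g1] [gM]]] /= fg; subst g.
by rewrite (Prop_irrelevance f1 g1) (Prop_irrelevance fM gM).
Qed.

Definition Grp : category.
Proof.
refine (@Category groupType (fun X Y => group_hom X Y)
  (fun X => (idfun : X -> X) : group_hom X X)
  (fun X Y Z g f => (g \o f) : group_hom X Z) _ _ _).
- by move=> X Y f; apply: group_hom_eq.
- by move=> X Y f; apply: group_hom_eq.
- by move=> X Y Z W h g f; apply: group_hom_eq.
Defined.

Variables (d : Order.disp_t) (L : cdDeMorganType d).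

Record slcg_hom (X Y : slcg L) := SLCGHom {
  slcg_fun :> group_hom X Y;
  slcg_fun_LCP : LCP (slcg_convex X) (slcg_convex Y) slcg_fun
}.

Lemma slcg_hom_eq (X Y : slcg L) (f g : slcg_hom X Y) :
  slcg_fun f = slcg_fun g -> f = g.
Proof.
case: f g => f fP [g gP] /= fg; subst g.
by rewrite (Prop_irrelevance fP gP).
Qed.

Definition slcg_id (X : slcg L) : slcg_hom X X :=
  @SLCGHom X X (idfun : X -> X) (fun A XA => XA).

Definition slcg_comp (X Y Z : slcg L) (g : slcg_hom Y Z) (f : slcg_hom X Y) :
    slcg_hom X Z :=
  @SLCGHom X Z (g \o f)
    (fun A ZA => slcg_fun_LCP f (slcg_fun_LCP g ZA)).

Definition SLCG_category : category.
Proof.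
refine (@Category (slcg L) slcg_hom slcg_id slcg_comp _ _ _).
- by move=> X Y f; apply: slcg_hom_eq; apply: group_hom_eq.
- by move=> X Y f; apply: slcg_hom_eq; apply: group_hom_eq.
- by move=> X Y Z W h g f; apply: slcg_hom_eq; apply: group_hom_eq.
Defined.

Definition SLCG_forget : functor SLCG_category Grp :=
  @Functor SLCG_category Grp (fun X => slcg_group X)
    (fun X Y f => slcg_fun f) (fun=> erefl) (fun _ _ _ _ _ => erefl).

Definition SLCG : concrete_category Grp :=
  @ConcreteCategory Grp SLCG_category SLCG_forget
    (fun X Y f g fg => slcg_hom_eq fg).

End Categories.

(* Main.v *)
Require Import Defs.
From HB Require Import structures.
From mathcomp Require Import all_boot all_order.
From mathcomp Require Import boolp classical_sets.

Set Implicit Arguments.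
Unset Strict Implicit.
Unset Printing Implicit Defensive.

Local Open Scope classical_set_scope.

(** The lift is the smallest stratified convex structure [C] on [X] making all
    the [f j] convexity-preserving, i.e. the initial structure
    ([initial_convex]). Initial structures are characterized by their universal
    property ([LCP_initialP]): a map into one preserves convexity as soon as its
    composites with the [f j] do. The reason is that the sets whose preimage
    under a given map is convex form a stratified convex structure
    ([stratified_convex_pushforward]), since pointwise infima and directed
    suprema commute with precomposition.

    The product structure is the initial structure of the two projections, so
    both group axioms for [C] follow from the universal property alone:
    [f j] composed with multiplication is multiplication of [G j] after the map
    [f j] on both components, which preserves convexity because its components
    do, and likewise for inversion.

    Uniqueness: if [C] and [D] both have the lifting property, testing it on the
    identity of [X] shows that each contains the other. For the categorical
    statement it remains to identify the morphisms of [SLCG L] with the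
    convexity-preserving homomorphisms ([is_morphismP]) and to eliminate the
    equality between the carrier of a lift and the domain of the source. *)

(** * Initial stratified convex structures *)

Section InitialConvex.
Context {d : Order.disp_t} {L : cdDeMorganType d}.

Lemma LCP_comp (X Y Z : Type) (C : set (X -> L)) (D : set (Y -> L))
    (E : set (Z -> L)) (g : Y -> Z) (f : X -> Y) :
  LCP D E g -> LCP C D f -> LCP C E (g \o f).
Proof. by move=> gP fP A EA; apply: (fP (A \o g)); apply: gP. Qed.

Lemma pSup_comp (X Y : Type) (f : X -> Y) (F : set (Y -> L)) :
  pSup F \o f = pSup [set A \o f | A in F].
Proof. by apply: funext => x; rewrite /pSup /= image_comp. Qed.

Lemma pInf_comp (X Y : Type) (f : X -> Y) (F : set (Y -> L)) :
  pInf F \o f = pInf [set A \o f | A in F].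
Proof. by apply: funext => x; rewrite /pInf /= image_comp. Qed.

Lemma directed_comp (X Y : Type) (f : X -> Y) (F : set (Y -> L)) :
  directed F -> directed [set A \o f | A in F].
Proof.
move=> [[A0 FA0] dirF]; split; first by exists (A0 \o f), A0.
move=> _ _ [A FA <-] [B FB <-]; have [D [FD AD BD]] := dirF _ _ FA FB.
exists (D \o f); split; first by exists D.
- by apply/lefP => x; move/lefP: AD; apply.
- by apply/lefP => x; move/lefP: BD; apply.
Qed.

(** The largest structure on [Y] for which [f] preserves convexity. *)
Lemma stratified_convex_pushforward (X Y : Type) (C : set (X -> L))
    (f : X -> Y) :
  stratified_convex C -> stratified_convex [set A : Y -> L | C (A \o f)].
Proof.
move=> [Ccst Cinf Csup]; split=> [a | F FC | F FC dirF] /=.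
- exact: Ccst.
- by rewrite pInf_comp; apply: Cinf => _ [A /FC CA <-].
- rewrite pSup_comp; apply: Csup; last exact: directed_comp.
  by move=> _ [A /FC CA <-].
Qed.

Lemma stratified_convex_bigcap (X I : Type) (P : set I)
    (E : I -> set (X -> L)) :
  (forall i, P i -> stratified_convex (E i)) ->
  stratified_convex (\bigcap_(i in P) E i).
Proof.
move=> EP; split=> [a | F FE | F FE dirF] i Pi; have [Ecst Einf Esup] := EP i Pi.
- exact: Ecst.
- by apply: Einf => A /FE; apply.
- by apply: Esup => // A /FE; apply.
Qed.

(** The smallest stratified convex structure on [X] for which all the [f j]
    preserve convexity. *)
Definition initial_convex (X J : Type) (Y : J -> Type)
    (D : forall j, set (Y j -> L)) (f : forall j, X -> Y j) : set (X -> L) :=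
  \bigcap_(E in [set E | stratified_convex E /\
                         forall j, LCP E (D j) (f j)]) E.

Lemma initial_convex_convex (X J : Type) (Y : J -> Type)
    (D : forall j, set (Y j -> L)) (f : forall j, X -> Y j) :
  stratified_convex (initial_convex D f).
Proof. by apply: stratified_convex_bigcap => E []. Qed.

Lemma LCP_initial (X J : Type) (Y : J -> Type)
    (D : forall j, set (Y j -> L)) (f : forall j, X -> Y j) j :
  LCP (initial_convex D f) (D j) (f j).
Proof. by move=> A DA E [_ EP]; apply: EP. Qed.

Lemma LCP_initialP (X J : Type) (Y : J -> Type)
    (D : forall j, set (Y j -> L)) (f : forall j, X -> Y j)
    (Z : Type) (C : set (Z -> L)) (g : Z -> X) :
  stratified_convex C ->
  LCP C (initial_convex D f) g <-> forall j, LCP C (D j) (f j \o g).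
Proof.
move=> Cconv; split=> [gP j | fgP A].
  by apply: LCP_comp gP; apply: LCP_initial.
move/(_ [set B : X -> L | C (B \o g)]); apply.
split; first exact: stratified_convex_pushforward.
by move=> j B DB; apply: fgP.
Qed.

Lemma prod_convex_convex (X Y : Type) (C : set (X -> L)) (D : set (Y -> L)) :
  stratified_convex (prod_convex C D).
Proof. by apply: stratified_convex_bigcap => E []. Qed.

Lemma LCP_fst (X Y : Type) (C : set (X -> L)) (D : set (Y -> L)) :
  LCP (prod_convex C D) C fst.
Proof. by move=> A CA E [_ EP _]; apply: EP. Qed.

Lemma LCP_snd (X Y : Type) (C : set (X -> L)) (D : set (Y -> L)) :
  LCP (prod_convex C D) D snd.
Proof. by move=> A DA E [_ _ EP]; apply: EP. Qed.

Lemma LCP_pair (X Y Z : Type) (C : set (X -> L)) (D : set (Y -> L))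
    (E : set (Z -> L)) (f : Z -> X) (g : Z -> Y) :
  stratified_convex E -> LCP E C f -> LCP E D g ->
  LCP E (prod_convex C D) (fun z => (f z, g z)).
Proof.
move=> Econv fP gP A.
move/(_ [set B : X * Y -> L | E (B \o (fun z => (f z, g z)))]); apply.
split; first exact: stratified_convex_pushforward.
- by move=> B CB; apply: fP.
- by move=> B DB; apply: gP.
Qed.

End InitialConvex.

(** * Initial lifts of families of group homomorphisms *)

Section GroupLift.
Context {d : Order.disp_t} {L : cdDeMorganType d}.
Variables (X : groupType) (J : Type) (G : J -> slcg L).
Variable f : forall j, group_hom X (G j).

Lemma convex_group_initial :
  convex_group (initial_convex (fun j => slcg_convex (G j)) f).
Proof.
set C := initial_convex _ _.
have Cconv : stratified_convex C by exact: initial_convex_convex.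
have fP j : LCP C (slcg_convex (G j)) (f j).
  exact: (LCP_initial (f := fun j => f j)).
split=> //.
- have Pconv := prod_convex_convex C C.
  apply/LCP_initialP => // j.
  have -> : f j \o (fun p : X * X => (p.1 * p.2)%g) =
            (fun q : G j * G j => (q.1 * q.2)%g) \o
            (fun p : X * X => (f j p.1, f j p.2)).
    by apply: funext => p /=; rewrite gmulfM.
  apply: LCP_comp; first exact: convex_group_mul (slcg_ax (G j)).
  apply: LCP_pair => //.
  + exact: LCP_comp (fP j) (@LCP_fst _ L X X C C).
  + exact: LCP_comp (fP j) (@LCP_snd _ L X X C C).
- apply/LCP_initialP => // j.
  have -> : f j \o (fun x : X => (x^-1)%g) = (fun y : G j => (y^-1)%g) \o f j.
    by apply: funext => x /=; rewrite gmulfV.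
  exact: LCP_comp (convex_group_inv (slcg_ax (G j))) (fP j).
Qed.

(** The convex structures turning the group [X] into a convex group that has
    the two properties of an initial lift of the family [f]. *)
Definition is_initial_structure (C : set (X -> L)) : Prop :=
  [/\ convex_group C,
      forall j, LCP C (slcg_convex (G j)) (f j)
    & forall (Y : slcg L) (g : group_hom Y X),
        LCP (slcg_convex Y) C g <->
        forall j, LCP (slcg_convex Y) (slcg_convex (G j)) (f j \o g)].

Lemma initial_structure_sub (C D : set (X -> L)) :
  is_initial_structure C -> is_initial_structure D -> C `<=` D.
Proof.
move=> [_ _ Cinit] [Dgrp Dlcp _].
(* the identity, seen as a homomorphism from (X, D) to (X, C) *)
have [_ idP] := Cinit (@SLCGroup _ L X D Dgrp) (idfun : X -> X).
by apply: idP => j; apply: Dlcp.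
Qed.

Lemma initial_structure_unique_existence : exists! C, is_initial_structure C.
Proof.
exists (initial_convex (fun j => slcg_convex (G j)) f).
have Cinit : is_initial_structure (initial_convex
    (fun j => slcg_convex (G j)) f).
  split; first exact: convex_group_initial.
  - exact: (LCP_initial (f := fun j => f j)).
  - move=> Y g; apply: LCP_initialP.
    exact: convex_group_convex (slcg_ax Y).
split=> // D Dinit.
by rewrite eqEsubset; split; apply: initial_structure_sub.
Qed.

End GroupLift.

(** * Topologicity *)

Lemma is_morphismP d (L : cdDeMorganType d) (a b : slcg L)
    (h : group_hom a b) :
  @is_morphism _ (SLCG L) a b h <-> LCP (slcg_convex a) (slcg_convex b) h.
Proof.
split=> [[g <-] | hP]; first exact: slcg_fun_LCP.
by exists (SLCGHom hP).
Qed.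

Theorem theorem5p2 (d : Order.disp_t) (L : cdDeMorganType d) :
  (forall (X : groupType) (J : Type) (G : J -> slcg L)
      (f : forall j, group_hom X (G j)),
    exists! C : set (X -> L),
      [/\ convex_group C,
          forall j, LCP C (slcg_convex (G j)) (f j)
        & forall (Y : slcg L) (g : group_hom Y X),
            LCP (slcg_convex Y) C g <->
            forall j, LCP (slcg_convex Y) (slcg_convex (G j)) (f j \o g)])
  /\ topological (SLCG L).
Proof.
split; first exact: initial_structure_unique_existence.
move=> [X J G f].
have [C [[Cgrp Clcp Cinit] Cuniq]] := initial_structure_unique_existence f.
pose a := @SLCGroup _ L X C Cgrp.
exists a; split.
  exists erefl; split=> [j | b h].
    by apply/(@is_morphismP _ L a (G j) (f j)); apply: Clcp.
  split=> [/(@is_morphismP _ L b a h)/Cinit hP j | hP].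
    by apply/(@is_morphismP _ L b (G j) (f j \o h)); apply: hP.
  apply/(@is_morphismP _ L b a h)/Cinit => j.
  by have /(@is_morphismP _ L b (G j) (f j \o h)) := hP j.
(* everything depending on [X] is generalized so that [e] can be eliminated,
   which replaces [X] by the underlying group [X'] of the other lift *)
move=> [X' C' C'grp] [/= e]; rewrite {}/a.
case: X / e f C Cgrp {Clcp Cinit} Cuniq => f C Cgrp Cuniq.
rewrite /eq_rect_r /= => -[fP C'init].
pose a' := @SLCGroup _ L X' C' C'grp.
have CC' : C = C'.
  apply: Cuniq; split=> // [j | Y g].
    exact: (iffLR (@is_morphismP _ L a' (G j) (f j)) (fP j)).
  split=> [gP j | gP].
    apply: (iffLR (@is_morphismP _ L Y (G j) (f j \o g))).
    apply: (iffLR (C'init Y g)).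
    exact: (iffRL (@is_morphismP _ L Y a' g)).
  apply: (iffLR (@is_morphismP _ L Y a' g)).
  apply: (iffRL (C'init Y g)) => j.
  exact: (iffRL (@is_morphismP _ L Y (G j) (f j \o g))).
case: C' / CC' C'grp @a' {fP C'init} => C'grp _.
by rewrite (Prop_irrelevance Cgrp C'grp).
Qed.
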